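(* Let $A$ be a Nakayama algebra with Loewy length $L(A)$ and $n$ simple modules (up to isomorphism). (1) Assume $L(A)\geq 2n$. Then there exists an indecomposable $A$-module $M$ with $\operatorname{Ext}^i_A(M,M)\neq 0$ for all $i>0$. (2) Assume $A$ has finite global dimension. Then $L(A)\leq 2n-1$.
   Context: Algebras are finite dimensional over a field $K$ and modules are finitely generated right modules. A Nakayama algebra is a finite dimensional algebra all of whose indecomposable projective left and right modules are uniserial. Standing assumption: $A$ is given as $KQ/I$ with $Q$ a connected quiver (a linearly oriented line or a linearly oriented cycle) and $I$ an admissible ideal. *)

(* Defs.v *)
From HB Require Import structures.
From mathcomp Require Import all_boot all_order all_algebra all_field.
From mathcomp Require Import finmap.
From mathcomp Require Import monalg.

Set Implicit Arguments.
Unset Strict Implicit.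
Unset Printing Implicit Defensive.

Import GRing.Theory.
Local Open Scope ring_scope.

(* Right A-modules are encoded as left modules over the converse ring A^c. *)

Section Modules.
Variable R : pzRingType.
Implicit Types M N : lmodType R.

Definition is_submod M (S : M -> Prop) : Prop :=
  S 0 /\ forall (a : R) (u v : M), S u -> S v -> S (a *: u + v).

Definition mod_nonzero M : Prop := exists x : M, x <> 0.

Definition fin_gen M : Prop :=
  exists (k : nat) (g : 'I_k -> M),
    forall x : M, exists c : 'I_k -> R, x = \sum_(i < k) c i *: g i.

Definition mod_iso M N : Prop := exists f : {linear M -> N}, bijective f.

Definition simple_mod M : Prop :=
  mod_nonzero M /\
  forall S : M -> Prop, is_submod S ->
    (forall x, S x -> x = 0) \/ (forall x, S x).

Definition indecomposable M : Prop :=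
  mod_nonzero M /\
  forall S T : M -> Prop, is_submod S -> is_submod T ->
    (forall x, exists y z, [/\ S y, T z & x = y + z]) ->
    (forall x, S x -> T x -> x = 0) ->
    (forall x, S x -> x = 0) \/ (forall x, T x -> x = 0).

Definition uniserial M : Prop :=
  forall S T : M -> Prop, is_submod S -> is_submod T ->
    (forall x, S x -> T x) \/ (forall x, T x -> S x).

Definition projective (P : lmodType R) : Prop :=
  forall (M N : lmodType R) (g : {linear M -> N}) (f : {linear P -> N}),
    (forall y, exists x, g x = y) ->
    exists h : {linear P -> M}, forall x, g (h x) = f x.

(* ... -> P_2 -> P_1 -> P_0 -> M -> 0, with res_d i : P_(i+1) -> P_i *)
Record proj_resolution M := ProjResolution {
  res_mod : nat -> lmodType R;
  res_d : forall i, {linear res_mod i.+1 -> res_mod i};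
  res_aug : {linear res_mod 0%N -> M};
  res_fin_gen : forall i, fin_gen (res_mod i);
  res_proj : forall i, projective (res_mod i);
  res_aug_surj : forall y, exists x, res_aug x = y;
  res_exact0 : forall x, res_aug x = 0 <-> exists y, res_d 0 y = x;
  res_exactS : forall i x, res_d i x = 0 <-> exists y, res_d i.+1 y = x
}.

Section Ext.
Variables (M N : lmodType R) (P : proj_resolution M).

(* kernel and image of the differentials of the complex Hom(P_*, N) *)
Definition ext_cocycle i (f : {linear res_mod P i -> N}) : Prop :=
  forall x, f (res_d P i x) = 0.

Definition ext_coboundary i : {linear res_mod P i -> N} -> Prop :=
  match i with
  | 0 => fun f => forall x, f x = 0
  | j.+1 => fun f =>
      exists g : {linear res_mod P j -> N}, forall x, f x = g (res_d P j x)
  end.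

End Ext.

(* Ext^i(M, N) <> 0, i.e. H^i(Hom(P_*, N)) has a nonzero class; by the
   comparison theorem the choice of the resolution P is irrelevant. *)
Definition Ext_nonzero M N (i : nat) : Prop :=
  exists (P : proj_resolution M) (f : {linear res_mod P i -> N}),
    ext_cocycle f /\ ~ ext_coboundary f.

Definition proj_dim_le M (d : nat) : Prop :=
  exists P : proj_resolution M,
    forall i, (d < i)%N -> forall x : res_mod P i, x = 0.

Definition finite_gldim : Prop :=
  exists d : nat, forall M, fin_gen M -> proj_dim_le M d.

End Modules.

Section Ideals.
Variable R : pzRingType.
Implicit Types I J : R -> Prop.

Definition right_ideal I : Prop :=
  [/\ I 0, forall x y, I x -> I y -> I (x + y) & forall x a, I x -> I (x * a)].

Definition two_sided_ideal I : Prop :=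
  right_ideal I /\ forall a x, I x -> I (a * x).

Definition maximal_right_ideal I : Prop :=
  [/\ right_ideal I, ~ (forall x, I x) &
      forall J, right_ideal J -> (forall x, I x -> J x) ->
        (forall x, J x -> I x) \/ (forall x, J x)].

Definition jacobson_radical : R -> Prop :=
  fun x => forall I, maximal_right_ideal I -> I x.

Definition ideal_generated (S : R -> Prop) : R -> Prop :=
  fun x => forall I, two_sided_ideal I -> (forall y, S y -> I y) -> I x.

Definition ideal_mul I J : R -> Prop :=
  fun x => exists (k : nat) (u v : 'I_k -> R),
    [/\ forall i, I (u i), forall i, J (v i) & x = \sum_(i < k) u i * v i].

Fixpoint ideal_exp I (m : nat) : R -> Prop :=
  if m is m'.+1 then ideal_mul I (ideal_exp I m') else fun _ => True.

(* least L with rad(R)^L = 0 *)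
Definition loewy_length (L : nat) : Prop :=
  (forall x, ideal_exp jacobson_radical L x -> x = 0) /\
  forall l, (forall x, ideal_exp jacobson_radical l x -> x = 0) -> (L <= l)%N.

End Ideals.

Record quiver := Quiver {
  vertex : finType;
  arrow : finType;
  source : arrow -> vertex;
  target : arrow -> vertex;
  vertex_gt0 : (0 < #|vertex|)%N
}.

Lemma card_ordS_gt0 (m : nat) : (0 < #|'I_m.+1|)%N.
Proof. by rewrite card_ord. Qed.

(* 0 -> 1 -> ... -> m, and the same with an additional arrow m -> 0 *)
Definition line_quiver (m : nat) : quiver :=
  @Quiver 'I_m.+1 'I_m (widen_ord (leqnSn m)) (lift ord0)
    (card_ordS_gt0 m).

Definition cycle_quiver (m : nat) : quiver :=
  @Quiver 'I_m.+1 'I_m.+1 id (@ordS m.+1)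
    (card_ordS_gt0 m).

Section PathAlgebra.
Variable Q : quiver.

Fixpoint walk (v : vertex Q) (s : seq (arrow Q)) : bool :=
  if s is a :: s' then (source a == v) && walk (target a) s' else true.

(* A path is its starting vertex together with its sequence of arrows. *)
Definition qpath := {p : vertex Q * seq (arrow Q) | walk p.1 p.2}.
HB.instance Definition _ := SubChoice.on qpath.

Definition path_start (p : qpath) : vertex Q := (val p).1.
Definition path_arrows (p : qpath) : seq (arrow Q) := (val p).2.
Definition path_end (p : qpath) : vertex Q :=
  last (path_start p) (map (@target Q) (path_arrows p)).

Definition trivial_path (v : vertex Q) : qpath := exist _ (v, [::]) isT.

Definition arrow_walk (a : arrow Q) : walk (source a) [:: a] :=
  introT andP (conj (eqxx (source a)) isT).
Definition arrow_path (a : arrow Q) : qpath :=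
  exist _ (source a, [:: a]) (arrow_walk a).

(* p followed by q, when q starts where p ends *)
Definition path_cat (p q : qpath) : option qpath :=
  if path_end p == path_start q
  then (insub (path_start p, path_arrows p ++ path_arrows q) : option qpath)
  else None.

Lemma walk_cat v s t :
  walk v (s ++ t) = walk v s && walk (last v (map (@target Q) s)) t.
Proof. by elim: s v => //= a s IHs v; rewrite IHs andbA. Qed.

Variant path_cat_spec (p q : qpath) : option qpath -> Prop :=
| PathCat r of path_end p = path_start q & path_start r = path_start p
    & path_arrows r = path_arrows p ++ path_arrows q
    & path_end r = path_end q : path_cat_spec p q (Some r)
| PathCatNone of path_end p <> path_start q : path_cat_spec p q None.

Lemma path_catP p q : path_cat_spec p q (path_cat p q).
Proof.
rewrite /path_cat; case: eqP => [e|]; last exact: PathCatNone.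
case: insubP => [r _ Er|].
  have Es : path_start r = path_start p by rewrite /path_start Er.
  have Ea : path_arrows r = path_arrows p ++ path_arrows q.
    by rewrite /path_arrows Er.
  by constructor=> //; rewrite /path_end Es Ea map_cat last_cat -e.
rewrite /= walk_cat (valP p) /=.
by move: e; rewrite /path_end /path_start /path_arrows => ->; rewrite (valP q).
Qed.

Lemma qpath_eq (p q : qpath) :
  path_start p = path_start q -> path_arrows p = path_arrows q -> p = q.
Proof.
case: p q => [[v s] w] [[v' s'] w']; rewrite /path_start /path_arrows /=.
by move=> ev es; apply: val_inj; rewrite /= ev es.
Qed.

Lemma path_catA p q r :
  obind (path_cat p) (path_cat q r) = obind (path_cat^~ r) (path_cat p q).
Proof.
case: (path_catP q r) => [qr e1 s1 a1 t1|n1];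
  case: (path_catP p q) => [pq e2 s2 a2 t2|n2] //=.
- case: (path_catP p qr) => [x ? ? ax ?|]; last by rewrite s1.
  case: (path_catP pq r) => [y ? ? ay ?|]; last by rewrite t2.
  congr Some; apply: qpath_eq; first by congruence.
  by rewrite ax ay a1 a2 catA.
- by case: (path_catP p qr) => //; rewrite s1.
- by case: (path_catP pq r) => //; rewrite t2.
Qed.

Lemma trivial_catl v p :
  path_cat (trivial_path v) p = if v == path_start p then Some p else None.
Proof.
case: (path_catP (trivial_path v) p) => [r e s a _|].
  by rewrite /path_end /= in e; rewrite -e eqxx; congr Some;
    apply: qpath_eq; rewrite ?s -?e.
by rewrite /path_end /= => /eqP/negbTE ->.
Qed.

Lemma trivial_catr v p :
  path_cat p (trivial_path v) = if v == path_end p then Some p else None.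
Proof.
case: (path_catP p (trivial_path v)) => [r e s a _|].
  have -> : v = path_end p by rewrite e.
  by rewrite eqxx; congr Some; apply: qpath_eq; rewrite ?s ?a ?cats0.
by move=> n; rewrite eq_sym; case: eqP.
Qed.

Variable K : fieldType.

(* KQ: finitely supported functions from paths to K *)
Definition path_algebra : Type := {malg K[qpath]}.
HB.instance Definition _ := GRing.Lmodule.on path_algebra.

Definition path_elt (p : qpath) : path_algebra := << p >>.
Definition opath_elt (p : option qpath) : path_algebra := oapp path_elt 0 p.

Definition pa_one : path_algebra := \sum_(v : vertex Q) path_elt (trivial_path v).

Definition pa_mul (g h : path_algebra) : path_algebra :=
  \sum_(p <- msupp g) \sum_(q <- msupp h)
    (g@_p * h@_q) *: opath_elt (path_cat p q).

Lemma pa_mulw (d1 d2 : {fset qpath}) (g h : path_algebra) :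
  (msupp g `<=` d1)%fset -> (msupp h `<=` d2)%fset ->
  pa_mul g h = \sum_(p <- d1) \sum_(q <- d2)
    (g@_p * h@_q) *: opath_elt (path_cat p q).
Proof.
move=> s1 s2; rewrite /pa_mul (big_fset_incl _ s1) /=.
  apply: eq_bigr => p _; rewrite (big_fset_incl _ s2) //= => q _.
  by move/mcoeff_outdom=> ->; rewrite mulr0 scale0r.
move=> p _ /mcoeff_outdom ->; rewrite big1 // => q _.
by rewrite mul0r scale0r.
Qed.

Lemma pa_mulDl : left_distributive pa_mul +%R.
Proof.
move=> g1 g2 h; pose d := (msupp g1 `|` msupp g2)%fset.
rewrite (pa_mulw (msuppD_le g1 g2) (fsubset_refl _)).
rewrite (pa_mulw (fsubsetUl (msupp g1) (msupp g2)) (fsubset_refl _)).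
rewrite (pa_mulw (fsubsetUr (msupp g1) (msupp g2)) (fsubset_refl _)).
rewrite -big_split; apply: eq_bigr => p _ /=.
rewrite -big_split; apply: eq_bigr => q _ /=.
by rewrite mcoeffD mulrDl scalerDl.
Qed.

Lemma pa_mulDr : right_distributive pa_mul +%R.
Proof.
move=> h g1 g2; pose d := (msupp g1 `|` msupp g2)%fset.
rewrite (pa_mulw (fsubset_refl _) (msuppD_le g1 g2)).
rewrite (pa_mulw (fsubset_refl _) (fsubsetUl (msupp g1) (msupp g2))).
rewrite (pa_mulw (fsubset_refl _) (fsubsetUr (msupp g1) (msupp g2))).
rewrite -big_split; apply: eq_bigr => p _ /=.
rewrite -big_split; apply: eq_bigr => q _ /=.
by rewrite mcoeffD mulrDr scalerDl.
Qed.

Lemma pa_mulZl c g h : pa_mul (c *: g) h = c *: pa_mul g h.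
Proof.
rewrite (pa_mulw (msuppZ_le c g) (fsubset_refl _)) /pa_mul scaler_sumr.
apply: eq_bigr => p _; rewrite scaler_sumr; apply: eq_bigr => q _.
by rewrite mcoeffZ scalerA mulrA.
Qed.

Lemma pa_mulZr c g h : pa_mul g (c *: h) = c *: pa_mul g h.
Proof.
rewrite (pa_mulw (fsubset_refl _) (msuppZ_le c h)) /pa_mul scaler_sumr.
apply: eq_bigr => p _; rewrite scaler_sumr; apply: eq_bigr => q _.
by rewrite mcoeffZ scalerA mulrCA.
Qed.

Lemma pa_mul0l h : pa_mul 0 h = 0.
Proof. by rewrite -(scale0r 0) pa_mulZl !scale0r. Qed.

Lemma pa_mul0r h : pa_mul h 0 = 0.
Proof. by rewrite -(scale0r 0) pa_mulZr !scale0r. Qed.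

Lemma pa_mul_suml I (r : seq I) (P : pred I) (F : I -> path_algebra) h :
  pa_mul (\sum_(i <- r | P i) F i) h = \sum_(i <- r | P i) pa_mul (F i) h.
Proof.
exact: (big_morph (pa_mul^~ h) (fun x y => pa_mulDl x y h) (pa_mul0l h)).
Qed.

Lemma pa_mul_sumr I (r : seq I) (P : pred I) (F : I -> path_algebra) h :
  pa_mul h (\sum_(i <- r | P i) F i) = \sum_(i <- r | P i) pa_mul h (F i).
Proof. exact: (big_morph (pa_mul h) (pa_mulDr h) (pa_mul0r h)). Qed.

Lemma path_eltE (g : path_algebra) :
  g = \sum_(p <- msupp g) g@_p *: path_elt p.
Proof.
rewrite [LHS]monalgE; apply: eq_bigr => p _.
by apply/malgP => k; rewrite mcoeffZ !mcoeffU mulrnAr mulr1.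
Qed.

Lemma pa_mul_elt p q :
  pa_mul (path_elt p) (path_elt q) = opath_elt (path_cat p q).
Proof.
rewrite (pa_mulw (msuppU_le (k := p)) (msuppU_le (k := q))).
by rewrite !big_seq_fset1 !mcoeffUU mulr1 scale1r.
Qed.

Lemma pa_mul_eltA p q r :
  pa_mul (path_elt p) (pa_mul (path_elt q) (path_elt r)) =
  pa_mul (pa_mul (path_elt p) (path_elt q)) (path_elt r).
Proof.
rewrite !pa_mul_elt; have := path_catA p q r.
case: (path_cat q r) => [x|]; case: (path_cat p q) => [y|] //= E;
  rewrite ?pa_mul0l ?pa_mul0r ?pa_mul_elt //; first by rewrite E.
- by rewrite E.
- by rewrite -E.
Qed.

Lemma pa_mulA : associative pa_mul.
Proof.
move=> x y z; rewrite (path_eltE x) [LHS]pa_mul_suml.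
rewrite [X in _ = pa_mul X z]pa_mul_suml [RHS]pa_mul_suml; apply: eq_bigr => p _.
rewrite [LHS]pa_mulZl [X in _ = pa_mul X z]pa_mulZl [RHS]pa_mulZl; congr (_ *: _).
rewrite (path_eltE y) [X in pa_mul _ X = _]pa_mul_suml [LHS]pa_mul_sumr.
rewrite [X in _ = pa_mul X z]pa_mul_sumr [RHS]pa_mul_suml; apply: eq_bigr => q _.
rewrite [X in pa_mul _ X = _]pa_mulZl [LHS]pa_mulZr.
rewrite [X in _ = pa_mul X z]pa_mulZr [RHS]pa_mulZl; congr (_ *: _).
rewrite (path_eltE z) [X in pa_mul _ X = _]pa_mul_sumr [LHS]pa_mul_sumr.
rewrite [RHS]pa_mul_sumr; apply: eq_bigr => r _.
by rewrite [X in pa_mul _ X = _]pa_mulZr [LHS]pa_mulZr [RHS]pa_mulZr pa_mul_eltA.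
Qed.

Lemma pa_mul1l : left_id pa_one pa_mul.
Proof.
move=> x; rewrite [in LHS](path_eltE x) pa_mul_sumr [RHS](path_eltE x).
apply: eq_bigr => p _; rewrite pa_mulZr; congr (_ *: _).
rewrite pa_mul_suml (bigD1 (path_start p)) //= pa_mul_elt trivial_catl eqxx /=.
rewrite big1 ?addr0 // => v nv.
by rewrite pa_mul_elt trivial_catl (negbTE nv).
Qed.

Lemma pa_mul1r : right_id pa_one pa_mul.
Proof.
move=> x; rewrite [in LHS](path_eltE x) pa_mul_suml [RHS](path_eltE x).
apply: eq_bigr => p _; rewrite pa_mulZl; congr (_ *: _).
rewrite pa_mul_sumr (bigD1 (path_end p)) //= pa_mul_elt trivial_catr eqxx /=.
rewrite big1 ?addr0 // => v nv.
by rewrite pa_mul_elt trivial_catr (negbTE nv).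
Qed.

Lemma pa_one_neq0 : pa_one != 0.
Proof.
have /card_gt0P[v _] := vertex_gt0 Q.
apply/negP => /eqP/(congr1 (mcoeff (trivial_path v)))/eqP.
rewrite mcoeff0 raddf_sum (bigD1 v) //= mcoeffUU big1 ?addr0 ?oner_eq0 //.
move=> w nw; rewrite mcoeffU.
case: eqP => // /(congr1 path_start); rewrite /path_start /= => e.
by rewrite e eqxx in nw.
Qed.

HB.instance Definition _ := GRing.Zmodule_isNzRing.Build path_algebra
  pa_mulA pa_mul1l pa_mul1r pa_mulDl pa_mulDr pa_one_neq0.
HB.instance Definition _ := GRing.Lmodule_isLalgebra.Build K path_algebra
  (fun c g h => esym (pa_mulZl c g h)).
HB.instance Definition _ := GRing.Lalgebra_isAlgebra.Build K path_algebra
  (fun c g h => esym (pa_mulZr c g h)).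

Definition arrow_ideal : path_algebra -> Prop :=
  ideal_generated (fun x => exists a : arrow Q, x = path_elt (arrow_path a)).

Definition admissible (I : path_algebra -> Prop) : Prop :=
  two_sided_ideal I /\
  exists m : nat,
    [/\ (2 <= m)%N,
        forall x, ideal_exp arrow_ideal m x -> I x &
        forall x, I x -> ideal_exp arrow_ideal 2 x].

End PathAlgebra.

Section Algebras.
Variables (K : fieldType) (A : falgType K).

Definition right_module := lmodType A^c.

Definition nakayama_algebra : Prop :=
  (forall P : lmodType A,
     fin_gen P -> projective P -> indecomposable P -> uniserial P) /\
  (forall P : right_module,
     fin_gen P -> projective P -> indecomposable P -> uniserial P).

(* A is isomorphic to KQ/I, as a surjection from KQ with kernel I *)
Definition quiver_quotient (Q : quiver) (I : path_algebra Q K -> Prop) : Prop :=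
  exists phi : {lrmorphism path_algebra Q K -> A},
    (forall a, exists x, phi x = a) /\ (forall x, phi x = 0 <-> I x).

Definition line_or_cycle_presentation : Prop :=
  exists (Q : quiver) (I : path_algebra Q K -> Prop),
    [/\ exists m, Q = line_quiver m \/ Q = cycle_quiver m,
        admissible I & quiver_quotient I].

Definition num_simples (n : nat) : Prop :=
  exists S : 'I_n -> right_module,
    [/\ forall i, simple_mod (S i),
        forall i j, mod_iso (S i) (S j) -> i = j &
        forall M : right_module, simple_mod M -> exists i, mod_iso M (S i)].

End Algebras.

(* Main.v *)
Require Import Defs.
From HB Require Import structures.
From mathcomp Require Import all_boot all_order all_algebra all_field.
From mathcomp Require Import generic_quotient.
From mathcomp Require Import finmap monalg.
From mathcomp Require Import zify.
From Stdlib Require Import Classical.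

(** Write A = KQ/I and let m be the number of vertices of Q.

    Each vertex v gives a character chi_v of A, reading off the coefficient of
    the trivial path at v.  These characters produce pairwise non-isomorphic
    simple modules, so m <= n ([card_vertex_le_simples]), and the radical lies
    in the common kernel of the chi_v, which is spanned by the classes of the
    paths of positive length.  Hence if every path of length l vanishes in A,
    then L <= l ([loewy_le]), and L >= 2n forces a nonzero path of length
    2n - 1.  On a line no path has length m or more, so Q is a cycle.

    On a cycle let alpha be the sum of the arrows and e_i the idempotent of
    the vertex i mod m.  The right ideal e_i A is uniserial: its submodules are
    the e_i alpha^w A for 0 <= w <= c_i, where c_i is the least k with
    e_i alpha^k = 0, and c_i <= c_(i+1) + 1.  The quotient
    M(i,w) = e_i A / e_i alpha^w A has the syzygy e_i alpha^w A, which is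
    isomorphic to M(i+w, c_i-w).  Iterating (i,w) |-> (i+w, c_i-w) gives a
    projective resolution ... -> e_(J_1) A -> e_(J_0) A whose k-th differential
    is left multiplication by alpha^(W_k) ([uniserial_resolution]).

    Choose i with c_i >= 2m and put M = M(i,m), in which every simple occurs
    exactly once.  Let d_k < m be the distance from i to J_k along the cycle.
    Then Hom(e_(J_k) A, M) is spanned by the map e_(J_k) |-> e_i alpha^(d_k).
    Such a map composed with the k-th differential has image in
    e_i alpha^(d_k + W_k) A, so all differentials of Hom(P, M) vanish as soon
    as d_k + W_k >= m for all k.  This holds because W_k is m for even k,
    and c_(J_k) - m for odd k, while c_(J_k) >= c_i - d_k >= 2m - d_k
    ([syzygy_depth]).  Hence Ext^k(M, M) is nonzero for every k
    ([uniserial_self_ext]).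

    The second part follows: over an algebra of finite global dimension, Ext
    vanishes in large degrees ([Ext_eq0_above_proj_dim], a comparison of two
    projective resolutions), so no such M exists and L >= 2n is impossible. *)

Set Implicit Arguments.
Unset Strict Implicit.
Unset Printing Implicit Defensive.
Import GRing.Theory.
Local Open Scope ring_scope.

(** * Comparison of projective resolutions *)

Section Lifting.
Variables (R : pzRingType) (U V W : lmodType R).
Variables (f : {linear U -> W}) (g : {linear V -> W}).

Definition fibre_product : {pred U * V} := fun p => f p.1 == g p.2.

Fact fibre_product_submod : submod_closed fibre_product.
Proof.
split=> [|a [x y] [x' y']]; first by rewrite unfold_in /= !linear0.
by rewrite !unfold_in /= !linearP => /eqP-> /eqP->.
Qed.

HB.instance Definition _ :=
  GRing.isSubmodClosed.Build R (U * V)%type fibre_product fibre_product_submod.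

Definition fibre_product_mod := {p : U * V | p \in fibre_product}.
HB.instance Definition _ := SubChoice.on fibre_product_mod.
HB.instance Definition _ :=
  [SubChoice_isSubLmodule of fibre_product_mod by <:].

(** A projective module only lifts along surjections onto the whole target; to
    lift f along a map g with a larger target, lift the identity of U along the
    projection of the fibre product of f and g onto U instead. *)
Lemma projective_lift :
  projective U -> (forall x, exists y, g y = f x) ->
  exists h : {linear U -> V}, forall x, g (h x) = f x.
Proof.
move=> projU fg.
pose p1 : {linear fibre_product_mod -> U} := fst \o val.
have [|h hE] := projU _ _ p1 idfun.
  move=> x; have [y gy] := fg x.
  have xy : (x, y) \in fibre_product by rewrite unfold_in /= gy.
  by exists (Sub (x, y) xy).
pose p2 : {linear fibre_product_mod -> V} := snd \o val.
exists (p2 \o h) => x /=; have /eqP/= <- := valP (h x).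
by congr (f _); apply: hE.
Qed.

End Lifting.

Arguments res_exact0 [R M] p x.
Arguments res_exactS [R M] p [i] x.
Arguments res_proj [R M] p i.

Section Comparison.
Variable R : pzRingType.
Implicit Types M N : lmodType R.

Lemma res_dd M (P : proj_resolution M) i x :
  res_d P i (res_d P i.+1 x) = 0.
Proof. by apply/(res_exactS P); exists x. Qed.

Lemma res_aug_d M (P : proj_resolution M) x : res_aug P (res_d P 0 x) = 0.
Proof. by apply/(res_exact0 P); exists x. Qed.

(** Membership in a chain map above phi, seen from its degree i component: the
    lower components are hidden under existential quantifiers, so that no
    sequence of choices is needed. *)
Fixpoint lifts_to M (P P' : proj_resolution M) (phi : M -> M) i :
    {linear res_mod P i -> res_mod P' i} -> Prop :=
  match i with
  | 0 => fun g => forall x, res_aug P' (g x) = phi (res_aug P x)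
  | j.+1 => fun g => exists g0, lifts_to phi g0 /\
      forall x, res_d P' j (g x) = g0 (res_d P j x)
  end.

Lemma lifts_to_cycle M (P P' : proj_resolution M) (phi : {linear M -> M}) i
    (g : {linear res_mod P i -> res_mod P' i}) :
  lifts_to phi g ->
  forall x, exists y, res_d P' i y = g (res_d P i x).
Proof.
case: i g => [|i] g /= => [gE x|[g0 [_ gE]] x].
  by apply/(res_exact0 P'); rewrite gE res_aug_d linear0.
by apply/(res_exactS P'); rewrite gE res_dd linear0.
Qed.

Lemma lifts_to_exists M (P P' : proj_resolution M) (phi : {linear M -> M}) i :
  exists g : {linear res_mod P i -> res_mod P' i}, lifts_to phi g.
Proof.
elim: i => [|i [g0 g0E]].
  have [|g gE] := @projective_lift _ _ _ _ (phi \o res_aug P) (res_aug P')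
                    (res_proj P 0); last by exists g.
  by move=> x; apply: res_aug_surj.
have [|g gE] := @projective_lift _ _ _ _ (g0 \o res_d P i) (res_d P' i)
                    (res_proj P i.+1); last by exists g, g0.
exact: (lifts_to_cycle g0E).
Qed.

Lemma lifts_to_comp M (P P' : proj_resolution M) i
    (g : {linear res_mod P i -> res_mod P' i})
    (h : {linear res_mod P' i -> res_mod P i}) :
  lifts_to id g -> lifts_to id h -> lifts_to (\0 : M -> M) (idfun \- (h \o g)).
Proof.
elim: i g h => [|i IHi] g h /= => [gE hE x|[g0 [g0l gE]] [h0 [h0l hE]]].
  by rewrite linearB /= hE gE subrr.
exists (idfun \- (h0 \o g0)); split; first exact: IHi.
by move=> x /=; rewrite linearB /= hE gE.
Qed.

(** A chain map above zero is null-homotopic.  The term t is the half of the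
    homotopy that factors through the differential leaving degree i; in degree
    0 it vanishes, which is what being an Ext coboundary means there. *)
Lemma null_homotopy M (P : proj_resolution M) i
    (g : {linear res_mod P i -> res_mod P i}) :
  lifts_to (\0 : M -> M) g ->
  exists s : {linear res_mod P i -> res_mod P i.+1},
  exists t : {linear res_mod P i -> res_mod P i},
    (forall x, g x = res_d P i (s x) + t x) /\
    @ext_coboundary _ _ _ P i t.
Proof.
elim: i g => [|i IHi] g /= => [gE|[g0 [/IHi[s0 [t0 [g0E t0E]]] gE]]].
  have [|s sE] := @projective_lift _ _ _ _ g (res_d P 0) (res_proj P 0).
    by move=> x; apply/(res_exact0 P); rewrite gE.
  by exists s, \0; split=> // x; rewrite sE addr0.
have [|s sE] := @projective_lift _ _ _ _ (g \- (s0 \o res_d P i)) (res_d P i.+1)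
                  (res_proj P i.+1).
  move=> x; apply/(res_exactS P) => /=.
  rewrite linearB /= gE g0E addrC addKr.
  case: i {IHi} g0 s0 t0 g0E t0E g gE x => [|i] g0 s0 t0 _ /= t0E g _ x //.
  by case: t0E => u ->; rewrite res_dd linear0.
exists s, (s0 \o res_d P i); split; last by exists s0.
by move=> x; rewrite sE /= subrK.
Qed.

(** Lift the identity of M to chain maps from a given resolution to one of
    length d and back.  In degree i > d the composite is zero, so the identity
    is d s + t there, and every cocycle f equals f t, a coboundary. *)
Lemma Ext_eq0_above_proj_dim M N d i :
  proj_dim_le M d -> (d < i)%N -> ~ Ext_nonzero M N i.
Proof.
case=> P' P'0 ltdi [P [f [fc]]]; apply.
have [g gl] := lifts_to_exists P P' idfun i.
have [h hl] := lifts_to_exists P' P idfun i.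
have [s [t [stE tb]]] := null_homotopy (lifts_to_comp gl hl).
have fE x : f x = f (t x).
  have /= := stE x; rewrite (P'0 _ ltdi (g x)) linear0 subr0 => xE.
  by rewrite [in LHS]xE linearD fc add0r.
case: i ltdi f fc {g gl h hl s stE} t tb fE => // i _ f _ t [u tE] fE.
by exists (f \o u) => x; rewrite fE tE.
Qed.

End Comparison.

(** * Quotient modules and right ideals generated by idempotents *)

Section QuotientModule.
Local Open Scope quotient_scope.
Variables (R : pzRingType) (M : lmodType R) (S : {pred M}).
Hypothesis S_submod : submod_closed S.

Definition submod_zmodClosed : zmodClosed M :=
  HB.pack S (GRing.isZmodClosed.Build M S (GRing.submod_closedB S_submod)).

Definition quot_mod : Type := Quotient.quot submod_zmodClosed.
HB.instance Definition _ := GRing.Zmodule.on quot_mod.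

Definition quot_proj (x : M) : quot_mod :=
  \pi_(Quotient.quot submod_zmodClosed) x.

Lemma quot_proj_surj q : exists x, quot_proj x = q.
Proof. by exists (repr q); rewrite /quot_proj reprK. Qed.

Lemma quot_proj_eq x y : quot_proj x = quot_proj y <-> x - y \in S.
Proof.
have /= -> : (x - y \in S) = _ := Quotient.idealrBE submod_zmodClosed x y.
by split=> /eqP.
Qed.

Fact quot_proj_zmod : zmod_morphism quot_proj.
Proof. by move=> x y; rewrite /quot_proj raddfB. Qed.
HB.instance Definition _ :=
  GRing.isZmodMorphism.Build M quot_mod quot_proj quot_proj_zmod.

Lemma quot_proj_eq0 x : quot_proj x = 0 <-> x \in S.
Proof. by rewrite -(raddf0 quot_proj) quot_proj_eq subr0. Qed.

Definition quot_scale (a : R) (q : quot_mod) := quot_proj (a *: repr q).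

Lemma quot_scaleE a x : quot_scale a (quot_proj x) = quot_proj (a *: x).
Proof.
apply/quot_proj_eq; rewrite -scalerBr.
case: S_submod => S0 SZ; rewrite -[_ *: _]addr0 SZ //; apply/quot_proj_eq.
by rewrite /quot_proj reprK.
Qed.

Fact quot_scaleA a b q : quot_scale a (quot_scale b q) = quot_scale (a * b) q.
Proof. by have [x <-] := quot_proj_surj q; rewrite !quot_scaleE scalerA. Qed.
Fact quot_scale1 : left_id 1 quot_scale.
Proof.
by move=> q; have [x <-] := quot_proj_surj q; rewrite quot_scaleE scale1r.
Qed.
Fact quot_scaleDr : right_distributive quot_scale +%R.
Proof.
move=> a p q; have [x <-] := quot_proj_surj p; have [y <-] := quot_proj_surj q.
by rewrite -raddfD !quot_scaleE scalerDr raddfD.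
Qed.
Fact quot_scaleDl q : {morph quot_scale^~ q : a b / a + b}.
Proof.
move=> a b; have [x <-] := quot_proj_surj q.
by rewrite !quot_scaleE scalerDl raddfD.
Qed.
HB.instance Definition _ := GRing.Zmodule_isLmodule.Build R quot_mod
  quot_scaleA quot_scale1 quot_scaleDr quot_scaleDl.

Fact quot_proj_scalable : scalable quot_proj.
Proof. by move=> a x; rewrite -quot_scaleE. Qed.
HB.instance Definition _ :=
  GRing.isScalable.Build R M quot_mod *:%R quot_proj quot_proj_scalable.

End QuotientModule.

Section RightIdeals.
Variable A : nzRingType.

Section Fixed.
Variable f : A.

Definition fixed_by : {pred A} := fun x => f * x == x.

Fact fixed_by_zmod : zmod_closed fixed_by.
Proof.
split=> [|x y]; rewrite !unfold_in ?mulr0 // mulrBr.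
by move=> /eqP-> /eqP->.
Qed.
HB.instance Definition _ := GRing.isZmodClosed.Build A fixed_by fixed_by_zmod.

(** For an idempotent f this is the right ideal f A. *)
Definition idem_mod := {x : A | x \in fixed_by}.
HB.instance Definition _ := SubChoice.on idem_mod.
HB.instance Definition _ := [SubChoice_isSubZmodule of idem_mod by <:].

Fact fixed_byM (a : A) (x : idem_mod) : val x * a \in fixed_by.
Proof. by have /eqP fx := valP x; rewrite unfold_in mulrA fx. Qed.

Definition idem_scale (a : A^c) (x : idem_mod) : idem_mod :=
  Sub (val x * (a : A)) (fixed_byM a x).

Fact idem_scaleA a b x : idem_scale a (idem_scale b x) = idem_scale (a * b) x.
Proof. by apply: val_inj => /=; rewrite -mulrA. Qed.
Fact idem_scale1 : left_id 1 idem_scale.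
Proof. by move=> x; apply: val_inj => /=; rewrite mulr1. Qed.
Fact idem_scaleDr : right_distributive idem_scale +%R.
Proof. by move=> a x y; apply: val_inj => /=; rewrite mulrDl. Qed.
Fact idem_scaleDl x : {morph idem_scale^~ x : a b / a + b}.
Proof. by move=> a b; apply: val_inj => /=; rewrite mulrDr. Qed.
HB.instance Definition _ := GRing.Zmodule_isLmodule.Build A^c idem_mod
  idem_scaleA idem_scale1 idem_scaleDr idem_scaleDl.

Lemma idem_scaleE (a : A^c) (x : idem_mod) : val (a *: x) = val x * (a : A).
Proof. by []. Qed.

Lemma fixedE (x : idem_mod) : f * val x = val x.
Proof. exact/eqP/(valP x). Qed.

Hypothesis ff : f * f = f.

Fact fixed_byl (x : A) : f * x \in fixed_by.
Proof. by rewrite unfold_in mulrA ff. Qed.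
Definition idem_elt (x : A) : idem_mod := Sub (f * x) (fixed_byl x).

Lemma idem_gen (x : idem_mod) : x = (val x : A^c) *: idem_elt 1.
Proof. by apply: val_inj; rewrite idem_scaleE /= mulr1 fixedE. Qed.

Lemma idem_mod_fin_gen : fin_gen (idem_mod : lmodType A^c).
Proof.
exists 1%N, (fun=> idem_elt 1) => x; exists (fun=> val x).
by rewrite big_ord1 -idem_gen.
Qed.

(** A map out of f A is determined by the image of f. *)
Lemma idem_mod_projective : projective (idem_mod : lmodType A^c).
Proof.
move=> M N g phi gs; have [m gm] := gs (phi (idem_elt 1)).
pose h (x : idem_mod) := (val x : A^c) *: m.
have hZ : linear h by move=> a x y; rewrite /h scalerA -scalerDl.
pose hL := GRing.isLinear.Build _ _ _ _ h hZ.
pose H : {linear idem_mod -> M} := HB.pack h hL.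
exists H => x; rewrite -[H x]/(h x) /h linearZ /= gm -linearZ.
by rewrite -idem_gen.
Qed.

End Fixed.

Section LeftMul.
Variables (f f' u : A).
Hypothesis ff : f * f = f.

Definition idem_lmul (x : idem_mod f') : idem_mod f := idem_elt ff (u * val x).
Fact idem_lmul_linear : linear idem_lmul.
Proof.
by move=> a x y; apply: val_inj => /=; rewrite -!mulrA mulrDr mulrDr !mulrA.
Qed.
HB.instance Definition _ := GRing.isLinear.Build _ _ _ _
  idem_lmul idem_lmul_linear.
End LeftMul.

End RightIdeals.

(** * Modules over a quotient of the path algebra of a cycle *)

(** What the presentation by a cycle of length n gives, in terms of the vertex
    idempotents e_i and the sum alpha of the arrows.  Indexing the vertices
    periodically by nat turns the shift along the cycle into i |-> i.+1, and
    e i * alpha ^+ k is the path of length k starting at i.  The numbers c i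
    form the Kupisch series: c i is the length of e_i A.  That the paths span A
    is stated as an induction principle, the form in which it is used. *)
Record cyclic_nakayama (K : fieldType) (A : falgType K) (n : nat)
    (e : nat -> A) (alpha : A) (c : nat -> nat) : Prop := CyclicNakayama {
  cyc_n_gt0 : (0 < n)%N;
  cyc_mod : forall i j, i = j %[mod n] -> e i = e j;
  cyc_orth : forall i j, e i * e j = if (i == j %[mod n])%N then e i else 0;
  cyc_shift : forall i, e i * alpha = alpha * e i.+1;
  cyc_kupisch : forall i k, (e i * alpha ^+ k == 0) = (c i <= k)%N;
  cyc_nilp : exists N, alpha ^+ N = 0;
  cyc_span : forall P : A -> Prop, P 0 ->
    (forall a x y, P x -> P y -> P (a *: x + y)) ->
    (forall i k, P (e i * alpha ^+ k)) -> forall x, P x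
}.

Section CyclicNakayama.
Variables (K : fieldType) (A : falgType K) (n : nat).
Variables (e : nat -> A) (alpha : A) (c : nat -> nat).
Hypothesis cycA : cyclic_nakayama n e alpha c.

Let n_gt0 := cyc_n_gt0 cycA.
Let e_mod := cyc_mod cycA.

Lemma e_idem i : e i * e i = e i.
Proof. by rewrite (cyc_orth cycA) eqxx. Qed.

Lemma e_alphaX i k : e i * alpha ^+ k = alpha ^+ k * e (i + k)%N.
Proof.
elim: k i => [|k IHk] i; first by rewrite addn0 mulr1 mul1r.
by rewrite exprS mulrA (cyc_shift cycA) -mulrA IHk addSnnS mulrA.
Qed.

Lemma e_alphaXS i k l : e i * alpha ^+ (k + l) = e i * alpha ^+ k * alpha ^+ l.
Proof. by rewrite exprD mulrA. Qed.

Lemma e_alpha_eq0 i k x : (c i <= k)%N -> e i * alpha ^+ k * x = 0.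
Proof. by rewrite -(cyc_kupisch cycA) => /eqP->; rewrite mul0r. Qed.

Lemma e_alphaXe i j k : j = (i + k)%N %[mod n] ->
  e i * alpha ^+ k * e j = e i * alpha ^+ k.
Proof. by move=> /e_mod ->; rewrite e_alphaX -mulrA e_idem. Qed.

Lemma mul_alphaX x k : exists y, x * alpha ^+ k = alpha ^+ k * y.
Proof.
move: x; apply: (cyc_span cycA) => [|a x y [x' xE] [y' yE]|i l].
- by exists 0; rewrite mul0r mulr0.
- by exists (a *: x' + y'); rewrite mulrDl mulrDr -scalerAl -scalerAr xE yE.
exists (e (i + k)%N * alpha ^+ l).
by rewrite -mulrA -exprD addnC exprD mulrA e_alphaX mulrA.
Qed.

(** e_i A is a local module: it is the sum of K e_i and e_i alpha A. *)
Lemma e_local i x : exists a y, e i * x = a *: e i + e i * alpha * y.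
Proof.
move: x; apply: (cyc_span cycA) => [|b x y [a [x' xE]] [a' [y' yE]]|j k].
- by exists 0, 0; rewrite !mulr0 scale0r addr0.
- exists (b * a + a'), (b *: x' + y').
  rewrite mulrDr -scalerAr xE yE scalerDr scalerA mulrDr -scalerAr scalerDl.
  by rewrite addrACA.
rewrite mulrA (cyc_orth cycA); case: eqP => _; last first.
  by exists 0, 0; rewrite mulr0 mul0r scale0r addr0.
case: k => [|k]; first by exists 1, 0; rewrite mulr0 mulr1 scale1r addr0.
by exists 0, (alpha ^+ k); rewrite scale0r add0r exprS mulrA.
Qed.

(** Right multiplication by alpha ^+ (c i - t.+1) kills the higher order part
    and leaves the nonzero path of length c i - 1. *)
Lemma leading_coef_eq0 i t a y :
  (t < c i)%N -> a *: (e i * alpha ^+ t) + e i * alpha ^+ t.+1 * y = 0 -> a = 0.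
Proof.
move=> ltt E; have [z zE] := mul_alphaX y (c i - t.+1).
have := congr1 ( *%R^~ (alpha ^+ (c i - t.+1))) E.
rewrite mul0r mulrDl -scalerAl -!mulrA zE -exprD !mulrA -e_alphaXS.
rewrite [X in _ + X]e_alpha_eq0; last by lia.
rewrite addr0 => /eqP; rewrite scaler_eq0 (cyc_kupisch cycA) => /orP[/eqP//|].
by lia.
Qed.

(** This is the uniseriality of e_j A: up to order s, an element is determined
    by its lowest path, because repeated use of [e_local] only meets paths
    starting at j. *)
Lemma leading_term j s x : e j * x = x ->
  (exists y, x = e j * alpha ^+ s * y) \/
  exists t a y, [/\ (t < s)%N, a != 0 &
    x = a *: (e j * alpha ^+ t) + e j * alpha ^+ t.+1 * y].
Proof.
move=> xE; elim: s => [|s [[y yE]|[t [a [y [lts a0 tE]]]]]].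
- by left; exists x; rewrite mulr1.
- have [a [z zE]] := e_local (j + s) y.
  have {}yE : x = a *: (e j * alpha ^+ s) + e j * alpha ^+ s.+1 * z.
    rewrite yE e_alphaX -mulrA zE mulrDr -scalerAr; congr (_ + _).
    by rewrite !mulrA -e_alphaX exprSr mulrA.
  have [a0|a0] := eqVneq a 0; last by right; exists s, a, z.
  by left; exists z; rewrite yE a0 scale0r add0r.
by right; exists t, a, y; split=> //; apply: ltnW.
Qed.

(** By [leading_term], an x outside e_(i+k) alpha ^+ (c i - k) A has a lowest
    path of length t < c i - k; multiplied by e_i alpha ^+ k it becomes a path
    of length less than c i, which is nonzero.  This is the exactness of the
    resolutions below. *)
Lemma left_annihilator i k x : (k <= c i)%N -> e (i + k)%N * x = x ->
  (e i * alpha ^+ k * x = 0 <->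
   exists y, x = e (i + k)%N * alpha ^+ (c i - k) * y).
Proof.
move=> lek xE; split=> [x0|[y ->]]; last first.
  by rewrite !mulrA e_alphaXe // -e_alphaXS e_alpha_eq0 // subnKC.
have [//|[t [a [y [lt_t a0 tE]]]]] := leading_term (c i - k) xE.
case/eqP: a0; apply: (@leading_coef_eq0 i (k + t) _ y); first by lia.
rewrite -x0 tE mulrDr -scalerAr !mulrA e_alphaXe //.
by rewrite -!e_alphaXS addnS.
Qed.

(** The submodule e_i alpha ^+ w A as the kernel of a right multiplication:
    membership becomes decidable, so that the quotient can be formed. *)
Lemma right_annihilator i w x : (w <= c i)%N -> e i * x = x ->
  (x * alpha ^+ (c i - w) = 0 <-> exists y, x = e i * alpha ^+ w * y).
Proof.
move=> lew xE; split=> [x0|[y ->]]; last first.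
  have [z zE] := mul_alphaX y (c i - w).
  by rewrite -mulrA zE mulrA -e_alphaXS e_alpha_eq0 // subnKC.
have [//|[t [a [y [lt_t a0 tE]]]]] := leading_term w xE.
have [z zE] := mul_alphaX y (c i - w).
case/eqP: a0; apply: (@leading_coef_eq0 i (t + (c i - w)) _ z); first by lia.
rewrite -x0 tE mulrDl -scalerAl -e_alphaXS; congr (_ + _).
by rewrite -[RHS]mulrA zE mulrA -e_alphaXS.
Qed.

(** Among the paths from i to j, only one is shorter than a full turn of the
    cycle. *)
Lemma corner i j d x : (d < n)%N -> j = (i + d)%N %[mod n] ->
  exists a y, e i * x * e j = a *: (e i * alpha ^+ d) + e i * alpha ^+ n * y.
Proof.
move=> ltd jE; rewrite (e_mod jE); move: x.
apply: (cyc_span cycA) => [|b x y [a [x' xE]] [a' [y' yE]]|l k].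
- by exists 0, 0; rewrite !(mulr0, mul0r) scale0r addr0.
- exists (b * a + a'), (b *: x' + y').
  rewrite mulrDr mulrDl -scalerAr -scalerAl xE yE scalerDr scalerA.
  by rewrite mulrDr -scalerAr scalerDl addrACA.
rewrite mulrA (cyc_orth cycA); case: eqP => _; last first.
  by exists 0, 0; rewrite !(mulr0, mul0r) scale0r addr0.
rewrite e_alphaX -mulrA (cyc_orth cycA) eqn_modDl.
case: eqP => [kd|_]; last first.
  by exists 0, 0; rewrite !(mulr0, mul0r) scale0r addr0.
rewrite -e_alphaX.
have [lekn|ltnk] := leqP n k.
  exists 0, (alpha ^+ (k - n)).
  by rewrite scale0r add0r -e_alphaXS subnKC.
exists 1, 0; rewrite mulr0 addr0 scale1r.
by move: kd; rewrite !modn_small // => ->.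
Qed.

(** Modulo the nilpotent ideal generated by alpha the first factor is a nonzero
    multiple of e_i; the error term is pushed to higher and higher powers of
    alpha, as in a geometric series. *)
Lemma e_unit i a y : a != 0 ->
  exists z, (a *: e i + e i * alpha * y) * z = e i.
Proof.
move=> a0; set x := _ *: _ + _.
suff step t : exists z r, x * z = e i + e i * alpha ^+ t.+1 * r.
  have [N aN0] := cyc_nilp cycA; have [z [r]] := step N.
  by rewrite exprS aN0 !mulr0 mul0r addr0; exists z.
elim: t => [|t [z [r zE]]].
  exists a^-1%:A, (a^-1 *: y); rewrite mulr_algr scalerDr scalerA mulVf //.
  by rewrite scale1r scalerAr.
have [s sE] := mul_alphaX r t.+1.
exists (z * (1 - alpha ^+ t.+1 * r)), (- (alpha ^+ t * s * r)).
set X := e i * alpha ^+ t.+1 * r in zE.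
have XE : X * (alpha ^+ t.+1 * r) = e i * alpha ^+ t.+2 * (alpha ^+ t * s * r).
  rewrite /X mulrA -[_ * r * _]mulrA sE mulrA -e_alphaXS -addSnnS e_alphaXS.
  by rewrite -!mulrA.
rewrite mulrA zE mulrBr mulr1 mulrDl XE [e i * (_ * _)]mulrA -/X.
by rewrite opprD addrA addrK mulrN.
Qed.

Lemma c_mod i j : i = j %[mod n] -> c i = c j.
Proof.
suff le_c i' j' : e i' = e j' -> (c i' <= c j')%N.
  move=> /e_mod ij; apply/eqP; rewrite eqn_leq !le_c //; exact: esym.
by move=> ij; rewrite -(cyc_kupisch cycA) ij (cyc_kupisch cycA).
Qed.

(** If e_(i+d) alpha ^+ k vanishes, then so does e_i alpha ^+ (d + k). *)
Lemma c_addr i d : (c i <= c (i + d) + d)%N.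
Proof.
rewrite -(cyc_kupisch cycA) addnC e_alphaXS e_alphaX -mulrA.
have /eqP-> : e (i + d)%N * alpha ^+ c (i + d) == 0 by rewrite (cyc_kupisch cycA).
by rewrite mulr0.
Qed.

Lemma eq_mod_pos i j : exists2 d, (d < n)%N & j = (i + d)%N %[mod n].
Proof.
exists ((j + (n - i %% n)) %% n)%N; first by rewrite ltn_mod.
rewrite modnDmr addnCA -modnDmr -(modnDml i) subnKC ?modnn ?addn0 //.
exact/ltnW/ltn_pmod.
Qed.

Section UniserialModule.
Variables (i w : nat).
Hypothesis lewc : (w <= c i)%N.

(** By [right_annihilator] this is e_i alpha ^+ w A when w <= c i. *)
Definition alphaX_sub : {pred idem_mod (e i)} :=
  fun x => val x * alpha ^+ (c i - w) == 0.

Fact alphaX_sub_submod :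
  submod_closed (alphaX_sub : {pred (idem_mod (e i) : lmodType A^c)}).
Proof.
split=> [|a x y]; rewrite !unfold_in /= ?mul0r // => /eqP x0 /eqP y0.
have [b bE] := mul_alphaX a (c i - w).
by rewrite mulrDl y0 addr0 -mulrA bE mulrA x0 mul0r.
Qed.

Definition uniserial_mod : lmodType A^c := quot_mod alphaX_sub_submod.
Definition uniserial_proj : {linear idem_mod (e i) -> uniserial_mod} :=
  quot_proj alphaX_sub_submod.

Lemma uniserial_proj_surj (m : uniserial_mod) : exists x, uniserial_proj x = m.
Proof. exact: quot_proj_surj. Qed.

Lemma uniserial_proj_eq0 x :
  uniserial_proj x = 0 <-> exists y, val x = e i * alpha ^+ w * y.
Proof.
rewrite -(right_annihilator lewc (fixedE x)); split=> [|x0].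
  by move/(quot_proj_eq0 alphaX_sub_submod)/eqP.
by apply/(quot_proj_eq0 alphaX_sub_submod)/eqP.
Qed.

Lemma uniserial_mod_fin_gen : fin_gen uniserial_mod.
Proof.
exists 1%N, (fun=> uniserial_proj (idem_elt (e_idem i) 1)) => m.
have [x <-] := uniserial_proj_surj m; exists (fun=> val x).
by rewrite big_ord1 -linearZ -idem_gen.
Qed.

(** The module is local: in a decomposition of the generator into s + t, one of
    the summands has a nonzero coefficient on e_i, and it generates the whole
    module by [e_unit]. *)
Lemma uniserial_mod_indecomposable : (0 < w)%N -> indecomposable uniserial_mod.
Proof.
move=> w0; pose u := uniserial_proj (idem_elt (e_idem i) 1).
have u_gen (S : uniserial_mod -> Prop) : is_submod S -> S u -> forall m, S m.
  move=> [S0 SZ] Su m; have [x <-] := uniserial_proj_surj m.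
  by rewrite [x](idem_gen (e_idem i)) linearZ /= -[X in S X]addr0; apply: SZ.
have local (S : uniserial_mod -> Prop) x a y : is_submod S -> a != 0 ->
    S (uniserial_proj x) -> val x = a *: e i + e i * alpha * y -> S u.
  move=> [S0 SZ] a0 Sx xE; have [z zE] := e_unit i y a0.
  have -> : u = (z : A^c) *: uniserial_proj x + 0.
    rewrite addr0 -linearZ; congr (uniserial_proj _).
    by apply: val_inj; rewrite /= xE zE mulr1.
  exact: SZ.
split.
  exists u => /uniserial_proj_eq0 /= [y]; rewrite mulr1 => uE.
  have := @leading_coef_eq0 i 0 1 (- (alpha ^+ w.-1 * y)) (leq_trans w0 lewc).
  rewrite scale1r mulr1 expr1 mulrN !mulrA {1}uE.
  rewrite -[in e i * alpha ^+ w](prednK w0) exprS mulrA subrr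
    => /(_ erefl)/eqP.
  by rewrite oner_eq0.
move=> S T Ssub Tsub ST_full ST0; have [s [t [Ss Tt uE]]] := ST_full u.
have [x xs] := uniserial_proj_surj s; have [a [y xE]] := e_local i (val x).
rewrite fixedE in xE; have [a0|a0] := eqVneq a 0; last first.
  right=> m Tm; apply: ST0 => //.
  by apply: u_gen => //; apply: (local S x a y); rewrite ?xs.
left=> m Sm; apply: ST0 => //; apply: u_gen => //.
apply: (local T (idem_elt (e_idem i) 1 - x) 1 (- y)); rewrite ?oner_eq0 //.
  by rewrite linearB /= xs -/u uE addrC addKr.
by rewrite /= xE a0 scale0r add0r mulr1 scale1r mulrN.
Qed.

(** The kernel of the projective cover of M(j,v) is e_j alpha^v A, a uniserial
    module with top at j + v and length c_j - v, that is M(j+v, c_j-v). *)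
Fixpoint syzygy k : nat * nat :=
  if k is k'.+1 then
    ((syzygy k').1 + (syzygy k').2, c (syzygy k').1 - (syzygy k').2)%N
  else (i, w).
Notation J k := (syzygy k).1.
Notation W k := (syzygy k).2.

Lemma syzygy_le k : (W k <= c (J k))%N.
Proof.
elim: k => [|k IHk] //=.
by have := c_addr (J k) (W k); lia.
Qed.

Definition syzygy_proj k : lmodType A^c := idem_mod (e (J k)).
Definition syzygy_d k : {linear syzygy_proj k.+1 -> syzygy_proj k} :=
  @idem_lmul A _ (e (J k.+1)) (alpha ^+ W k) (e_idem (J k)).

Lemma val_syzygy_d k x : val (syzygy_d k x) = e (J k) * alpha ^+ W k * val x.
Proof. by rewrite /= mulrA. Qed.

Lemma syzygy_d_im k x :
  (exists y, syzygy_d k y = x) <-> (exists z, val x = e (J k) * alpha ^+ W k * z).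
Proof.
split=> [[y <-]|[z xE]]; first by exists (val y); rewrite val_syzygy_d.
exists (idem_elt (e_idem (J k.+1)) z); apply: val_inj.
by rewrite val_syzygy_d /= mulrA e_alphaXe.
Qed.

Fact syzygy_exact k x :
  syzygy_d k x = 0 <-> exists y, syzygy_d k.+1 y = x.
Proof.
rewrite syzygy_d_im -(left_annihilator (syzygy_le k) (fixedE x)).
rewrite -val_syzygy_d; split=> [->//|x0]; exact: val_inj.
Qed.

Fact syzygy_exact0 x : uniserial_proj x = 0 <-> exists y, syzygy_d 0 y = x.
Proof. by rewrite uniserial_proj_eq0 (@syzygy_d_im 0). Qed.

Definition uniserial_resolution : proj_resolution uniserial_mod :=
  @ProjResolution _ _ syzygy_proj syzygy_d uniserial_proj
    (fun k => idem_mod_fin_gen (e_idem (J k)))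
    (fun k => idem_mod_projective (e_idem (J k)))
    uniserial_proj_surj syzygy_exact0 syzygy_exact.

End UniserialModule.

Section SelfExtensions.
Variable i : nat.
Hypothesis le2c : (2 * n <= c i)%N.

Fact le_n_c : (n <= c i)%N. Proof. by lia. Qed.
Notation M := (uniserial_mod i n).
Notation J k := (syzygy i n k).1.
Notation W k := (syzygy i n k).2.

(** A step by n does not change the vertex, so the lengths n and c - n
    alternate. *)
Lemma syzygy_alternates k : W k = n \/ W k = (c (J k) - n)%N.
Proof.
elim: k => [|k [] Wk]; [by left|right|left] => /=.
  by rewrite Wk (c_mod (modnDr _ n)).
rewrite Wk subKn //; have [d ltd JE] := eq_mod_pos i (J k).
by have := c_addr i d; rewrite -(c_mod JE); lia.
Qed.

(** The vertex J k lies d steps after i, hence c (J k) is at least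
    c i - d >= 2 n - d, which settles the case W k = c (J k) - n. *)
Lemma syzygy_depth k d :
  (d < n)%N -> J k = (i + d)%N %[mod n] -> (n <= d + W k)%N.
Proof.
move=> ltd JE; have := c_addr i d; rewrite -(c_mod JE).
by case: (syzygy_alternates k) => ->; lia.
Qed.

(** The class is the map e_(J (k+1)) |-> e_i alpha ^+ d.  It is a cocycle by
    [syzygy_depth] in degree k + 1, and by [corner] and [syzygy_depth] in
    degree k every coboundary vanishes, while e_i alpha ^+ d is nonzero in M
    because d < n. *)
Lemma uniserial_self_ext k : Ext_nonzero M M k.+1.
Proof.
have [d ltd JE] := eq_mod_pos i (J k.+1).
pose f : {linear syzygy_proj i n k.+1 -> M} :=
  uniserial_proj i n \o @idem_lmul A _ (e (J k.+1)) (alpha ^+ d) (e_idem i).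
exists (uniserial_resolution le_n_c), f; split=> [x|[g gE]].
  apply/(uniserial_proj_eq0 le_n_c); exists (alpha ^+ (d + W k.+1 - n) * val x).
  have := val_syzygy_d x; rewrite /= => ->.
  rewrite !mulrA e_alphaXe // -!e_alphaXS subnKC //.
  exact: (@syzygy_depth k.+1).
have [d' ltd' JE'] := eq_mod_pos i (J k).
have [z zE] := uniserial_proj_surj (g (idem_elt (e_idem (J k)) 1)).
(* a coboundary sends the generator to g e_(J k) alpha ^+ W k, and g e_(J k)
   lies in M e_(J k), hence in e_i alpha ^+ d' A *)
have f0 : f (idem_elt (e_idem (J k.+1)) 1) = 0.
  rewrite gE.
  have -> : res_d (uniserial_resolution le_n_c) k (idem_elt (e_idem (J k.+1)) 1) =
      (e (J k) * alpha ^+ W k : A^c) *: idem_elt (e_idem (J k)) 1.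
    apply: val_inj; rewrite [LHS]val_syzygy_d /= !mulr1 mulrA e_idem.
    by rewrite e_alphaXe.
  rewrite linearZ /= -zE -linearZ; apply/(uniserial_proj_eq0 le_n_c) => /=.
  have [a [y xE]] := corner (val z) ltd' JE'.
  rewrite mulrA -[val z]fixedE xE mulrDl -scalerAl -e_alphaXS.
  have [t tE] := mul_alphaX y (W k).
  exists (a *: alpha ^+ (d' + W k - n) + alpha ^+ W k * t).
  rewrite mulrDr -scalerAr -e_alphaXS subnKC; last exact: syzygy_depth.
  by rewrite -[_ * y * _]mulrA tE.
have /(uniserial_proj_eq0 le_n_c)[y] := f0.
rewrite /= mulr1 mulrA e_alphaXe // => dE.
have := @leading_coef_eq0 i d 1 (- (alpha ^+ (n - d.+1) * y)).
rewrite scale1r mulrN mulrA -e_alphaXS subnKC // dE subrr => H.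
have /eqP := H (leq_trans ltd le_n_c) erefl.
by rewrite oner_eq0.
Qed.

End SelfExtensions.
End CyclicNakayama.

(** * Characters and their simple modules *)

Section Characters.
Variables (K : fieldType) (A : falgType K).

(** The one-dimensional right module on which A acts through chi. *)
Definition char_mod (chi : {lrmorphism A -> K^o}) : Type := K.

Section CharacterModule.
Variable chi : {lrmorphism A -> K^o}.

HB.instance Definition _ := GRing.Zmodule.on (char_mod chi).

Definition char_scale (a : A^c) (k : char_mod chi) : char_mod chi := k * chi a.
Fact char_scaleA a b k : char_scale a (char_scale b k) = char_scale (a * b) k.
Proof. by rewrite /char_scale -[a * b]/((b : A) * (a : A)) rmorphM mulrA. Qed.
Fact char_scale1 : left_id 1 char_scale.
Proof. by move=> k; rewrite /char_scale rmorph1 mulr1. Qed.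
Fact char_scaleDr : right_distributive char_scale +%R.
Proof. by move=> a k l; rewrite /char_scale mulrDl. Qed.
Fact char_scaleDl k : {morph char_scale^~ k : a b / a + b}.
Proof. by move=> a b; rewrite /char_scale raddfD mulrDr. Qed.
HB.instance Definition _ := GRing.Zmodule_isLmodule.Build A^c (char_mod chi)
  char_scaleA char_scale1 char_scaleDr char_scaleDl.

Lemma chi_alg a : chi a%:A = a.
Proof. by rewrite linearZ /= rmorph1 [LHS]mulr1. Qed.

Lemma char_mod_simple : simple_mod (char_mod chi).
Proof.
split; first by exists (1 : K); apply/eqP/oner_neq0.
move=> S [S0 SZ];
case: (classic (forall x, S x -> x = 0)) => [|nS]; first by left.
right=> y; have [x nSx] := not_all_ex_not _ _ nS.
have [Sx /eqP x0] := imply_to_and _ _ nSx.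
have := SZ ((x : K)^-1 * (y : K))%:A x 0 Sx S0.
rewrite addr0; congr S.
by rewrite -[_ *: _]/(_ * chi _) chi_alg mulVKf.
Qed.

Lemma ker_char_maximal : maximal_right_ideal (fun x => chi x = 0).
Proof.
split.
- split=> [|x y x0 y0|x a x0]; first exact: raddf0.
  + by rewrite raddfD /= x0 y0 addr0.
  + by rewrite rmorphM /= x0 mul0r.
- by move/(_ 1)/eqP; rewrite rmorph1 oner_eq0.
move=> J [J0 JD JM] sub_J.
case: (classic (forall x, J x -> chi x = 0)) => [|nJ]; first by left.
right=> y; have [x nJx] := not_all_ex_not _ _ nJ.
have [Jx /eqP x0] := imply_to_and _ _ nJx.
rewrite -[y](subrK (x * ((chi x)^-1 * chi y)%:A)); apply: JD; last exact: JM.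
apply: sub_J; rewrite raddfB /= rmorphM /= chi_alg mulVKf ?subrr //.
Qed.

End CharacterModule.

(** If b is in the kernel of chi, it annihilates a module isomorphic to
    char_mod chi, so it annihilates char_mod psi and is in the kernel of psi;
    apply this to b = a - chi a. *)
Lemma char_mod_iso_eq (chi psi : {lrmorphism A -> K^o}) (N : right_module A) :
  mod_iso (char_mod chi) N -> mod_iso (char_mod psi) N -> chi =1 psi.
Proof.
move=> [f f_bij] [g g_bij] a.
have [g' _ gK] := g_bij; pose k := g' (f (1 : K)).
pose b := a - (chi a)%:A.
have fb0 : (b : A^c) *: f (1 : K) = 0.
  rewrite -linearZ -[_ *: _]/((1 : K) * chi b) mul1r.
  by rewrite raddfB /= chi_alg subrr linear0.
have k0 : (k : K) != 0.
  apply/eqP => k0; have := gK (f (1 : K)); rewrite -/k k0 linear0.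
  rewrite -(linear0 f) => /(bij_inj f_bij)/esym/eqP.
  by rewrite (negbTE (oner_neq0 K)).
have : g ((b : A^c) *: k) = g 0 by rewrite linearZ /= gK fb0 linear0.
move/(bij_inj g_bij)/eqP; rewrite -[_ *: _]/((k : K) * psi b) mulf_eq0.
by rewrite (negbTE k0) raddfB /= chi_alg subr_eq0 => /eqP.
Qed.

End Characters.

Lemma lrmorphism_factor (K : fieldType) (A B C : algType K)
    (phi : {lrmorphism B -> A}) (psi : {lrmorphism B -> C}) :
  (forall a, exists x, phi x = a) -> (forall x, phi x = 0 -> psi x = 0) ->
  exists chi : {lrmorphism A -> C}, forall x, chi (phi x) = psi x.
Proof.
move=> phi_surj ker_phi.
have lift a : exists x, phi x == a by have [x <-] := phi_surj a; exists x.
pose chi a := psi (xchoose (lift a)).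
have chiE x : chi (phi x) = psi x.
  apply/eqP; rewrite -subr_eq0 -raddfB; apply/eqP/ker_phi.
  by rewrite raddfB /= (eqP (xchooseP (lift _))) subrr.
have chiL : linear chi.
  move=> k a b; have [x <-] := phi_surj a; have [y <-] := phi_surj b.
  by rewrite -linearP !chiE linearP.
have chiM : monoid_morphism chi.
  split=> [|a b]; first by rewrite -(rmorph1 phi) chiE rmorph1.
  have [x <-] := phi_surj a; have [y <-] := phi_surj b.
  by rewrite -rmorphM !chiE rmorphM.
pose chiLB := GRing.isLinear.Build _ _ _ _ chi chiL.
pose chiMB := GRing.isMonoidMorphism.Build _ _ chi chiM.
pose chi' : {lrmorphism A -> C} := HB.pack chi chiLB chiMB.
by exists chi'.
Qed.

(** * Paths, vertex characters and the Loewy length *)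

Section Paths.
Variables (Q : quiver) (K : fieldType).
Notation KQ := (path_algebra Q K).
Notation "<| p |>" := (path_elt K p) (format "<| p |>").
Notation len p := (size (path_arrows p)).

Lemma path_eltM (p q : qpath Q) : <|p|> * <|q|> = opath_elt K (path_cat p q).
Proof. exact: pa_mul_elt. Qed.

Lemma path_algebra_ind (P : KQ -> Prop) : P 0 ->
  (forall a x y, P x -> P y -> P (a *: x + y)) -> (forall p, P <|p|>) ->
  forall x, P x.
Proof.
move=> P0 PZ Pp x; rewrite (path_eltE x).
elim: (X in \sum_(i <- X) _) => [|p s IHs].
  by rewrite big_nil.
by rewrite big_cons; apply: PZ.
Qed.

Lemma path_elt_coeff (p q : qpath Q) : <|p|>@_q = (p == q)%:R.
Proof. by rewrite mcoeffU. Qed.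

Lemma path_cons p a s : path_arrows p = a :: s ->
  exists q : qpath Q, [/\ path_start p = source a, path_start q = target a,
    path_arrows q = s & <|p|> = <|arrow_path a|> * <|q|>].
Proof.
case: p => [[v t] /= w]; rewrite /path_arrows /path_start /= => tE.
have /andP[/eqP av w'] : (source a == v) && walk (target a) s.
  by have := w; rewrite /= tE.
exists (exist _ (target a, s) w'); split=> //.
rewrite path_eltM; case: path_catP => [r _ sr ar _|]; last by [].
by congr path_elt; apply: qpath_eq;
  rewrite ?sr ?ar /path_start /path_arrows /= ?tE.
Qed.

Definition vertex_coeff (v : vertex Q) (x : KQ) : K^o := x@_(trivial_path v).

Fact vertex_coeff_linear v : linear (vertex_coeff v).
Proof. by move=> a x y; rewrite /vertex_coeff mcoeffD mcoeffZ. Qed.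
HB.instance Definition _ v := GRing.isLinear.Build _ _ _ _
  (vertex_coeff v) (vertex_coeff_linear v).

Lemma trivial_pathP (v : vertex Q) p :
  reflect (path_start p = v /\ path_arrows p = [::]) (p == trivial_path v).
Proof.
apply: (iffP eqP) => [-> //|[pv ps]].
by apply: qpath_eq; rewrite ?pv ?ps.
Qed.

Lemma vertex_coeffP v a (x y : KQ) :
  (a *: x + y)@_(trivial_path v) = a * x@_(trivial_path v) + y@_(trivial_path v).
Proof. by rewrite mcoeffD mcoeffZ. Qed.

(** On paths: a concatenation is the trivial path at v if and only if both of
    its factors are. *)
Lemma vertex_coeff_mul v (x y : KQ) :
  (pa_mul x y)@_(trivial_path v) = x@_(trivial_path v) * y@_(trivial_path v).
Proof.
move: x; apply: path_algebra_ind => [|a x1 x2 E1 E2|p].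
- by rewrite pa_mul0l mcoeff0 mul0r.
- rewrite pa_mulDl pa_mulZl (vertex_coeffP v a (pa_mul x1 y)).
  rewrite (vertex_coeffP v a x1) mulrDl -mulrA.
  exact: congr2 (congr1 ( *%R a) E1) E2.
move: y; apply: path_algebra_ind => [|a y1 y2 E1 E2|q].
- by rewrite pa_mul0r mcoeff0 mulr0.
- rewrite pa_mulDr pa_mulZr (vertex_coeffP v a (pa_mul _ y1)).
  rewrite (vertex_coeffP v a y1) mulrDr mulrCA.
  exact: congr2 (congr1 ( *%R a) E1) E2.
have cE r : <|r|>@_(trivial_path v) = (r == trivial_path v)%:R :> K.
  exact: path_elt_coeff.
suff E : (opath_elt K (path_cat p q))@_(trivial_path v) =
    ((p == trivial_path v) && (q == trivial_path v))%:R :> K.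
  rewrite pa_mul_elt; apply: etrans E _; rewrite -mulnb natrM.
  exact: (congr2 *%R (esym (cE p)) (esym (cE q))).
case: path_catP => [r pq sr ar er|npq] /=; last first.
  rewrite mcoeff0; case: andP => //.
  move=> [/trivial_pathP[p1 p2] /trivial_pathP[q1 q2]].
  by case: npq; rewrite /path_end p2 /= p1 q1.
suff <- : (r == trivial_path v) = (p == trivial_path v) && (q == trivial_path v).
  exact: cE.
apply/trivial_pathP/andP => [[rv]|[/trivial_pathP[p1 p2] /trivial_pathP[q1 q2]]].
  rewrite ar => /nilP; rewrite /nilp size_cat addn_eq0.
  move=> /andP[/nilP p0 /nilP q0].
  have pv : path_start p = v by rewrite -sr.
  by split; apply/trivial_pathP; split=> //; rewrite -pq /path_end p0.
by rewrite sr ar p1 p2 q2.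
Qed.

Fact vertex_coeff_monoid v : monoid_morphism (vertex_coeff v).
Proof.
split; last exact: vertex_coeff_mul.
rewrite /vertex_coeff; change ((pa_one Q K)@_(trivial_path v) = 1).
rewrite raddf_sum (bigD1 v) //= [X in X + _]path_elt_coeff eqxx.
rewrite big1 ?addr0 // => u /negPf nuv; rewrite path_elt_coeff.
by case: trivial_pathP => // -[]; rewrite /path_start /= => /eqP; rewrite nuv.
Qed.
HB.instance Definition _ v := GRing.isMonoidMorphism.Build _ _
  (vertex_coeff v) (vertex_coeff_monoid v).

Lemma arrow_ideal_coeff0 v (x : KQ) : arrow_ideal x -> vertex_coeff v x = 0.
Proof.
move/(_ (fun y => vertex_coeff v y = 0)); apply; last first.
  move=> _ [a ->]; apply: etrans (path_elt_coeff _ _) _.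
  by case: trivial_pathP => // -[].
split; last by move=> a y /= y0; rewrite rmorphM /= y0 mulr0.
split=> [|y z y0 z0|y a y0]; first exact: raddf0.
  by rewrite raddfD /= y0 z0 addr0.
by rewrite rmorphM /= y0 mul0r.
Qed.

Lemma arrow_ideal_exp_coeff0 l v (x : KQ) :
  ideal_exp (@arrow_ideal Q K) l.+1 x -> vertex_coeff v x = 0.
Proof.
case=> k [y [z [y_in _ ->]]]; rewrite raddf_sum big1 // => i _ /=.
by rewrite rmorphM /= arrow_ideal_coeff0 // mul0r.
Qed.

Lemma path_in_arrow_ideal l p :
  (l <= len p)%N -> ideal_exp (@arrow_ideal Q K) l <|p|>.
Proof.
elim: l p => [//|l IHl] p lep.
case pE: (path_arrows p) lep => [//|a s] les.
have [q [_ _ qE ->]] := path_cons pE.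
exists 1%N, (fun=> <|arrow_path a|>), (fun=> <|q|>); rewrite big_ord1.
split=> // _; last by apply: IHl; rewrite qE.
by move=> J _ JS; apply: JS; exists a.
Qed.

(** The l-th power of the arrow ideal, described by coefficients. *)
Definition long l (x : KQ) := forall p, (len p < l)%N -> x@_p = 0.

Lemma long_mul k l x y : long k x -> long l y -> long (k + l) (x * y).
Proof.
move=> kx ly r ltr; rewrite -[x * y]/(pa_mul x y) /pa_mul.
rewrite raddf_sum big1_seq // => p /= px; rewrite raddf_sum big1_seq //= => q qy.
rewrite mcoeffZ.
have lep : (k <= len p)%N.
  by rewrite leqNgt; apply: contraL px => /kx/eqP; rewrite mcoeff_eq0.
have leq' : (l <= len q)%N.
  by rewrite leqNgt; apply: contraL qy => /ly/eqP; rewrite mcoeff_eq0.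
case: path_catP => [s _ _ sE _|_] /=; last by rewrite mcoeff0 mulr0.
rewrite path_elt_coeff; case: eqP ltr => [<-|_ _]; last by rewrite mulr0.
by rewrite sE size_cat ltnNge leq_add.
Qed.

End Paths.

Section Presentation.
Variables (Q : quiver) (K : fieldType) (A : falgType K).
Variable phi : {lrmorphism path_algebra Q K -> A}.
Hypothesis phi_surj : forall a, exists x, phi x = a.
Notation len p := (size (path_arrows p)).
Notation "<| p |>" := (path_elt K p) (format "<| p |>").

Section Characters.
Hypothesis ker_phi : forall x v, phi x = 0 -> vertex_coeff v x = 0.

Lemma vertex_characters : exists chi : vertex Q -> {lrmorphism A -> K^o},
  forall v x, chi v (phi x) = vertex_coeff v x.
Proof.
apply: (@fin_all_exists _ _ (fun v (chi : {lrmorphism A -> K^o}) =>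
  forall x, chi (phi x) = vertex_coeff v x)) => v.
by apply: lrmorphism_factor => // x /(ker_phi v).
Qed.

Lemma card_vertex_le_simples n : num_simples A n -> (#|vertex Q| <= n)%N.
Proof.
move=> [S [_ _ S_all]]; have [chi chiE] := vertex_characters.
have [s sP] : exists s : vertex Q -> 'I_n,
    forall v, mod_iso (char_mod (chi v)) (S (s v)).
  apply: (@fin_all_exists _ _ (fun v i => mod_iso (char_mod (chi v)) (S i))) => v.
  exact: S_all (char_mod_simple _).
rewrite -[n]card_ord; apply: (@leq_card _ _ s) => u v suv.
have := sP v; rewrite -suv => /(char_mod_iso_eq (sP u)).
have tE w : vertex_coeff w <|trivial_path v|> =
    (trivial_path v == trivial_path w)%:R.
  exact: path_elt_coeff.
move=> /(_ (phi <|trivial_path v|>)); rewrite !chiE !tE eqxx.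
case: trivial_pathP => [[vu _] _|_ /esym/eqP]; first by rewrite -vu.
by rewrite oner_eq0.
Qed.

(** The kernel of each vertex character is a maximal right ideal, so an element
    of the radical lifts to a combination of paths of positive length. *)
Lemma radical_exp_long l (a : A) : ideal_exp (@jacobson_radical A) l a ->
  exists2 x, phi x = a & long l x.
Proof.
elim: l a => [|l IHl] a; first by have [x <-] := phi_surj a; exists x.
have [chi chiE] := vertex_characters.
case=> k [u [v [u_rad v_rad ->]]].
have [x xP] : exists x : 'I_k -> path_algebra Q K,
    forall i, phi (x i) = u i /\ long 1 (x i).
  apply: (@fin_all_exists _ _ (fun i y => phi y = u i /\ long 1 y)) => i.
  have [y yE] := phi_surj (u i); exists y; split=> // p.
  rewrite ltnS leqn0 size_eq0 => /eqP p0.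
  have -> : p = trivial_path (path_start p) by apply/eqP/trivial_pathP.
  apply: etrans (esym (chiE (path_start p) y)) _; rewrite yE.
  exact: (u_rad i) (ker_char_maximal _).
have [y yP] : exists y : 'I_k -> path_algebra Q K,
    forall i, phi (y i) = v i /\ long l (y i).
  apply: (@fin_all_exists _ _ (fun i z => phi z = v i /\ long l z)) => i.
  by have [z zE zl] := IHl _ (v_rad i); exists z.
exists (\sum_(i < k) x i * y i).
  rewrite raddf_sum; apply: eq_bigr => i _ /=.
  by rewrite rmorphM /= (xP i).1 (yP i).1.
move=> p ltp; rewrite raddf_sum big1 // => i _.
exact: (long_mul (xP i).2 (yP i).2 ltp).
Qed.

Lemma loewy_le L l : loewy_length A L ->
  (forall p : qpath Q, (l <= len p)%N -> phi <|p|> = 0) -> (L <= l)%N.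
Proof.
move=> [_ L_min] phi0; apply: L_min => a /radical_exp_long[x <- x_long].
rewrite (path_eltE x) raddf_sum big1_seq // => p /= px; rewrite linearZ /=.
rewrite phi0 ?scaler0 // leqNgt; apply: contraL px => /x_long/eqP.
by rewrite mcoeff_eq0.
Qed.

End Characters.
End Presentation.

(** * Line and cycle quivers *)

Lemma line_walk_le m (v : 'I_m.+1) s :
  @walk (line_quiver m) v s -> (v + size s <= m)%N.
Proof.
elim: s v => [|a s IHs] v /=; first by rewrite addn0 -ltnS.
move=> /andP[/eqP <- /IHs] /=; rewrite /bump /=; lia.
Qed.

Section Cycle.
Variables (m : nat) (K : fieldType) (A : falgType K).
Notation Q := (cycle_quiver m).
Variable phi : {lrmorphism path_algebra Q K -> A}.
Hypothesis phi_surj : forall a, exists x, phi x = a.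
Notation len p := (size (path_arrows p)).
Notation "<| p |>" := (path_elt K p) (format "<| p |>").
Variable N : nat.
Hypothesis phi_nilp : forall p : qpath Q, (N <= len p)%N -> phi <|p|> = 0.

Definition cyc_vertex (i : nat) : vertex Q := inord (i %% m.+1).
Definition cyc_arrows : path_algebra Q K := \sum_(a : arrow Q) <|arrow_path a|>.
Definition cyc_idem i : A := phi <|trivial_path (cyc_vertex i)|>.
Definition cyc_alpha : A := phi cyc_arrows.

Lemma trivial_mul_arrows (v : vertex Q) :
  <|trivial_path v|> * cyc_arrows = <|arrow_path (v : arrow Q)|>.
Proof.
have vE a : pa_mul <|trivial_path v|> <|arrow_path a|> =
    if a == v then <|arrow_path a|> else 0.
  by rewrite pa_mul_elt trivial_catl eq_sym; case: ifP.
apply: etrans (pa_mul_sumr _ _ _ _) _.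
apply: etrans (eq_bigr _ (fun a _ => vE a)) _.
by rewrite -big_mkcond big_pred1_eq.
Qed.

Lemma arrows_mul_trivial (v : vertex Q) :
  cyc_arrows * <|@trivial_path Q (ordS v)|> = <|arrow_path (v : arrow Q)|>.
Proof.
have vE a : pa_mul <|arrow_path a|> <|@trivial_path Q (ordS v)|> =
    if a == v then <|arrow_path a|> else 0.
  rewrite pa_mul_elt trivial_catr /path_end /= (inj_eq (@ordS_inj _)) eq_sym.
  by case: ifP.
apply: etrans (pa_mul_suml _ _ _ _) _.
apply: etrans (eq_bigr _ (fun a _ => vE a)) _.
by rewrite -big_mkcond big_pred1_eq.
Qed.

(** Exactly one arrow leaves each vertex, so a path is determined by its start
    and its length. *)
Lemma path_elt_arrows (p : qpath Q) :
  <|p|> = <|trivial_path (path_start p)|> * cyc_arrows ^+ len p.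
Proof.
move sE: (path_arrows p) => s; elim: s p sE => [|a s IHs] p pE.
  by rewrite mulr1; congr path_elt; apply/eqP/trivial_pathP.
have [q [sp sq /IHs qE ->]] := path_cons K pE.
have aE : <|arrow_path a|> * <|@trivial_path Q (ordS a)|> = <|arrow_path a|>.
  by apply: etrans (pa_mul_elt _ _ _) _; rewrite trivial_catr eqxx.
have ring_id (R : nzRingType) (x t u y : R) k :
  x * t = x -> u * y = x -> x * (t * y ^+ k) = u * y ^+ k.+1.
- by move=> xt uy; rewrite exprS !mulrA xt uy.
by rewrite sp qE sq; apply: ring_id aE (trivial_mul_arrows a).
Qed.

Lemma cyc_vertexS i : cyc_vertex i.+1 = ordS (cyc_vertex i).
Proof.
apply: val_inj; rewrite /= !inordK ?ltn_pmod //.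
by rewrite -addn1 -modnDml addn1.
Qed.

Lemma cyc_vertex_eq i j :
  (cyc_vertex i == cyc_vertex j) = (i == j %[mod m.+1])%N.
Proof. by rewrite -val_eqE /= !inordK ?ltn_pmod. Qed.

Lemma phi_trivial (v : vertex Q) : phi <|trivial_path v|> = cyc_idem v.
Proof.
congr (phi <|trivial_path _|>).
by apply: val_inj; rewrite /= inordK modn_small.
Qed.

Lemma path_exists (v : vertex Q) k :
  exists p : qpath Q, path_start p = v /\ len p = k.
Proof.
elim: k v => [|k IHk] v; first by exists (trivial_path v).
have [[[u s] w] [pv pk]] := IHk (ordS v).
have w' : walk v ((v : arrow Q) :: s).
  by have := w; rewrite /= eqxx -[u]/(path_start (exist _ (u, s) w)) pv.
by exists (exist _ (v, (v : arrow Q) :: s) w'); split; rewrite // -pk.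
Qed.

Lemma phi_path (p : qpath Q) :
  phi <|p|> = cyc_idem (path_start p) * cyc_alpha ^+ len p.
Proof.
by rewrite {1}path_elt_arrows rmorphM rmorphXn /= phi_trivial.
Qed.

Lemma cycle_cyclic_nakayama :
  exists c, cyclic_nakayama m.+1 cyc_idem cyc_alpha c.
Proof.
have e0 i k : (N <= k)%N -> cyc_idem i * cyc_alpha ^+ k = 0.
  move=> leNk; have [p [ps pk]] := path_exists (cyc_vertex i) k.
  have -> : cyc_idem i = cyc_idem (path_start p) by rewrite -phi_trivial ps.
  by rewrite -pk -phi_path phi_nilp ?pk.
have c_ex i : exists k, cyc_idem i * cyc_alpha ^+ k == 0.
  by exists N; rewrite e0.
exists (fun i => ex_minn (c_ex i)); split.
- by [].
- by move=> i j ij; rewrite /cyc_idem; congr (phi <|trivial_path _|>); apply/eqP;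
    rewrite cyc_vertex_eq ij.
- move=> i j; rewrite /cyc_idem -rmorphM -cyc_vertex_eq.
  apply: etrans (congr1 phi (pa_mul_elt _ _ _)) _; rewrite trivial_catl.
  rewrite -[path_start _]/(cyc_vertex j).
  by case: eqP => [->|_] //; apply: raddf0.
- move=> i; rewrite /cyc_idem /cyc_alpha -!rmorphM cyc_vertexS.
  by rewrite trivial_mul_arrows arrows_mul_trivial.
- move=> i k; case: ex_minnP => c /eqP c0 c_min; apply/idP/idP => [/c_min //|lek].
  by rewrite -(subnKC lek) exprD mulrA c0 mul0r.
- exists N; rewrite -[LHS]mul1r -(rmorph1 phi).
  have -> : (1 : path_algebra Q K) = \sum_(v : vertex Q) <|trivial_path v|> by [].
  rewrite raddf_sum mulr_suml big1 // => v _.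
  by rewrite -[X in X * _]/(phi <|trivial_path v|>) phi_trivial e0.
move=> P P0 PZ Pe a; have [x <-] := phi_surj a.
move: x; apply: path_algebra_ind => [|b x y Px Py|p]; first by rewrite raddf0.
- by rewrite linearP; apply: PZ.
- by rewrite phi_path; apply: Pe.
Qed.
End Cycle.

(** * Self-extensions in all degrees *)

Lemma exists_self_ext (K : fieldType) (A : falgType K) (L n : nat) :
  line_or_cycle_presentation A -> loewy_length A L -> num_simples A n ->
  (2 * n <= L)%N ->
  exists M : right_module A, fin_gen M /\ indecomposable M /\
    forall i : nat, (0 < i)%N -> Ext_nonzero M M i.
Proof.
move=> [Q [I [[m Qm] [_ [N [_ NI I2]]] [phi [phi_surj phiI]]]]] loewyA simplesA.
move=> le2nL; have ker_phi x v : phi x = 0 -> vertex_coeff v x = 0.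
  by move=> /phiI/I2; apply: arrow_ideal_exp_coeff0.
have phi_nilp (p : qpath Q) :
  (N <= size (path_arrows p))%N -> phi (path_elt K p) = 0.
  by move=> leNp; apply/phiI/NI/path_in_arrow_ideal.
have le_v := card_vertex_le_simples phi_surj ker_phi simplesA.
have v_gt0 := vertex_gt0 Q.
have le_L l := loewy_le phi_surj ker_phi loewyA (l := l).
case: Qm => QE; subst Q.
  (* on a line L <= m.+1 <= n, against 2 n <= L *)
  have : (L <= m.+1)%N.
    apply: le_L => p lep.
    have := leq_trans (leq_addl _ _) (line_walk_le (valP p)).
    by move=> /(leq_trans lep); rewrite ltnn.
  by move: le_v; rewrite /= card_ord; lia.
have {}le_v : (m.+1 <= n)%N by move: le_v; rewrite /= card_ord.
have [c cycA] := cycle_cyclic_nakayama phi_surj phi_nilp.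
case: (classic (exists i, 2 * n <= c i)%N) => [[i le2nc]|no_long]; last first.
  suff : (L <= 2 * n - 1)%N by lia.
  apply: le_L => p lep; rewrite phi_path; apply/eqP.
  rewrite (cyc_kupisch cycA) leqNgt; apply/negP => ltpc.
  by apply: no_long; exists (path_start p : 'I_m.+1); lia.
(* only the number of vertices of the cycle matters from here on *)
have le2c : (2 * m.+1 <= c i)%N by lia.
exists (uniserial_mod cycA i m.+1); split; first exact: uniserial_mod_fin_gen.
split; first by apply: uniserial_mod_indecomposable => //; lia.
by case=> // k _; apply: uniserial_self_ext.
Qed.

Theorem proposition1p8 (K : fieldType) (A : falgType K) (L n : nat)
  (nakA : nakayama_algebra A) (presA : line_or_cycle_presentation A)
  (loewyA : loewy_length A L) (simplesA : num_simples A n) :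
  ((2 * n <= L)%N ->
     exists M : right_module A,
       fin_gen M /\ indecomposable M /\
       forall i : nat, (0 < i)%N -> Ext_nonzero M M i) /\
  (finite_gldim A^c -> (L <= 2 * n - 1)%N).
Proof.
have self_ext := exists_self_ext presA loewyA simplesA.
split=> // -[d gldim_d]; have [//|] := leqP L (2 * n - 1).
case: (ltnP L (2 * n)) => [|/self_ext[M [fgM [_ extM]]] _]; first by lia.
by case: (Ext_eq0_above_proj_dim (gldim_d M fgM) (ltnSn d) (extM d.+1 isT)).
Qed.
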